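(* If $G$ is a graph of order $n$ and $\overline{G}$ is the complement of $G$, then $$\|G\|_*-\|\overline{G}\|_*\le 2\lambda_1(G)$$ and $$\|\overline{G}\|_*-\|G\|_*\le 2\lambda_1(\overline{G}).$$
   Context: Graphs are finite, simple and undirected; the order of a graph is its number of vertices. The energy $\|G\|_*$ of a graph $G$ is the sum of the absolute values of the eigenvalues of its adjacency matrix (counted with multiplicity). $\lambda_1(G)$ denotes the largest eigenvalue of the adjacency matrix of $G$. *)

(* Defs.v *)
From mathcomp Require Import all_boot all_order all_algebra.
From mathcomp Require Import polyrcf.

Set Implicit Arguments.
Unset Strict Implicit.
Unset Printing Implicit Defensive.

Import Order.TTheory GRing.Theory Num.Theory.
Local Open Scope ring_scope.

(* Finite simple graphs of order n, on the vertex set 'I_n. *)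
Record sgraph (n : nat) := SGraph {
  adj :> rel 'I_n;
  adj_sym : symmetric adj;
  adj_irr : irreflexive adj }.

Definition compl_rel n (G : sgraph n) : rel 'I_n :=
  fun x y => (x != y) && ~~ G x y.

Lemma compl_rel_sym n (G : sgraph n) : symmetric (compl_rel G).
Proof. by move=> x y; rewrite /compl_rel eq_sym adj_sym. Qed.

Lemma compl_rel_irr n (G : sgraph n) : irreflexive (compl_rel G).
Proof. by move=> x; rewrite /compl_rel eqxx. Qed.

Definition compl n (G : sgraph n) : sgraph n :=
  SGraph (compl_rel_sym G) (compl_rel_irr G).

Definition adjmx (R : rcfType) n (G : sgraph n) : 'M[R]_n :=
  \matrix_(i, j) (G i j)%:R.

(* The eigenvalues of A lying in R, each repeated according to its multiplicity
   as a root of the characteristic polynomial.  For a symmetric A this is the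
   whole spectrum, since its characteristic polynomial splits over R. *)
Definition eigenvalues (R : rcfType) n (A : 'M[R]_n) : seq R :=
  flatten [seq nseq (mup x (char_poly A)) x | x <- rootsR (char_poly A)].

Lemma mem_eigenvalues (R : rcfType) n (A : 'M[R]_n) x :
  (x \in eigenvalues A) = eigenvalue A x.
Proof.
have p0 : char_poly A != 0 by rewrite monic_neq0 ?char_poly_monic.
have rE y : (y \in rootsR (char_poly A)) = root (char_poly A) y.
  by rewrite -(roots_on_rootsR p0) in_itv.
rewrite eigenvalue_root_char; apply/flatten_mapP/idP => [[y]|rx].
  by rewrite mem_nseq rE => ry /andP[_ /eqP->].
by exists x; rewrite ?rE // mem_nseq eqxx andbT -XsubC_dvd ?dvdp_XsubCl.
Qed.

Definition energy (R : rcfType) n (G : sgraph n) : R :=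
  \sum_(x <- eigenvalues (adjmx R G)) `|x|.

(* Starting the maximum at an element of the list makes it the true maximum;
   the default 0 is only reached for n = 0, where there are no eigenvalues. *)
Definition lambda1 (R : rcfType) n (G : sgraph n) : R :=
  let s := eigenvalues (adjmx R G) in \big[Num.max/head 0 s]_(x <- s) x.

(* Main.v *)
Require Import Defs.
From mathcomp Require Import all_boot all_order all_algebra.
From mathcomp Require Import complex polyrcf.

Set Implicit Arguments.
Unset Strict Implicit.
Unset Printing Implicit Defensive.

(** Let A and B be the adjacency matrices of a graph and of its complement, so
    that A + B + 1 = u^* u, where u is the all-ones row. Both traces vanish, so
    each energy is twice the sum of the positive eigenvalues, and also twice the
    sum of the absolute values of the negative ones ([sum_norm_pos],
    [sum_norm_neg]). It is therefore enough to bound the positive eigenvalues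
    of A by lambda1(A) plus the absolute values of the negative eigenvalues of B
    ([sum_pos_spectrum_le]).

    Let P be the orthogonal projection onto the span of the eigenvectors of A
    with positive eigenvalue, so that tr (A P) is the sum of the positive
    eigenvalues. Inside the range of P, split off the line spanned by u P:
    P = N + Q, where N projects onto that line (N = 0 if u P = 0) and the range
    of Q is orthogonal to u. As N has rank at most one, tr (A N) <= lambda1(A).
    As u Q = 0, tr (A Q) = tr (u^* u Q) - tr Q - tr (B Q) <= - tr (B Q), and
    - tr (B Q) is at most the sum of the absolute values of the negative
    eigenvalues of B. No ordering of the spectra and no interlacing is involved:
    both estimates follow from [trace_mul_orthoproj], which writes the trace of
    a Hermitian matrix times a projection as a combination of the eigenvalues
    with weights in [0, 1].

    The unitary diagonalization takes place over R[i]; [symmetric_spectrum]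
    identifies the diagonal obtained there with the list of real roots of the
    characteristic polynomial, multiplicities included. *)

Import Order.TTheory GRing.Theory Num.Theory.
Local Open Scope ring_scope.
Local Open Scope sesquilinear_scope.

(** * Eigenvalues as roots of the characteristic polynomial *)

Lemma char_poly_conj (F : fieldType) n (P D : 'M[F]_n) :
  P \in unitmx -> char_poly (invmx P *m D *m P) = char_poly D.
Proof.
move=> Pu; rewrite /char_poly.
have PVP : map_mx polyC (invmx P) *m map_mx polyC P = 1%:M.
  by rewrite -map_mxM mulVmx // map_mx1.
have -> : char_poly_mx (invmx P *m D *m P) =
    map_mx polyC (invmx P) *m char_poly_mx D *m map_mx polyC P.
  rewrite /char_poly_mx mulmxBr mulmxBl !map_mxM -!mulmxA; congr (_ - _).
  by rewrite mulmxA mul_mx_scalar -scalemxAl PVP scalemx1.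
by rewrite !det_mulmx mulrAC -det_mulmx PVP det1 mul1r.
Qed.

(** A splitting of the characteristic polynomial determines its root list: the
    multiplicity of a root in a product of linear factors is its number of
    occurrences among them. *)
Lemma perm_eigenvalues (R : rcfType) n (A : 'M[R]_n) (s : seq R) :
  char_poly A = \prod_(y <- s) ('X - y%:P) -> perm_eq (eigenvalues A) s.
Proof.
move=> pE; apply/allP => /= x _; apply/eqP.
have p0 : char_poly A != 0 by rewrite monic_neq0 ?char_poly_monic.
rewrite /= -(mu_prod_XsubC x s) -pE /eigenvalues count_flatten -map_comp.
rewrite sumnE big_map.
have tU : uniq (rootsR (char_poly A)) by exact: uniq_roots.
have [xr|xNr] := boolP (x \in rootsR (char_poly A)).
  rewrite (bigD1_seq x) //= count_nseq /= eqxx mul1n big1 ?addn0 // => y yx.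
  by rewrite count_nseq /= (negPf yx).
rewrite big_seq big1 => [|y yr]; last first.
  by rewrite /= count_nseq /=; case: eqVneq yr xNr => // -> ->.
by rewrite mupNroot //; move: xNr; rewrite -(roots_on_rootsR p0) in_itv.
Qed.

(** * Traces against orthogonal projections *)

Section Projections.
Variable C : numClosedFieldType.

Lemma trmxCM m n p (A : 'M[C]_(m, n)) (B : 'M[C]_(n, p)) :
  (A *m B)^t* = B^t* *m A^t*.
Proof. by rewrite trmx_mul map_mxM. Qed.

Definition orthoproj n (Q : 'M[C]_n) := Q^t* = Q /\ Q *m Q = Q.

Lemma orthoproj_compl n (Q : 'M[C]_n) : orthoproj Q -> orthoproj (1%:M - Q).
Proof.
case=> QH QQ; split.
  by rewrite linearB /= map_mxB QH tr_scalar_mx map_scalar_mx /= conjC1.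
by rewrite mulmxBl mul1mx mulmxBr mulmx1 QQ subrr subr0.
Qed.

(** The diagonal entries of Q = Q Q^* are squared norms of the rows of Q. *)
Lemma orthoproj_diag_ge0 n (Q : 'M[C]_n) i : orthoproj Q -> 0 <= Q i i.
Proof.
case=> QH QQ; rewrite -QQ -{2}QH mxE sumr_ge0 // => k _.
by rewrite !mxE mul_conjC_ge0.
Qed.

Lemma orthoproj_diag_le1 n (Q : 'M[C]_n) i : orthoproj Q -> Q i i <= 1.
Proof.
move=> /orthoproj_compl /(orthoproj_diag_ge0 i).
by rewrite !mxE eqxx subr_ge0.
Qed.

Lemma orthoproj_conj n (W Q : 'M[C]_n) :
  W \is unitarymx -> orthoproj Q -> orthoproj (W *m Q *m W^t*).
Proof.
move=> Wu [QH QQ]; split; first by rewrite !trmxCM trmxCK QH mulmxA.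
by rewrite !mulmxA mulmxKtV // -(mulmxA W) QQ.
Qed.

(** In an orthonormal eigenbasis of B, the projection Q becomes another
    projection, whose diagonal entries are the weights [q]. *)
Lemma trace_mul_orthoproj n (B Q : 'M[C]_n) :
    B \is hermsymmx -> orthoproj Q ->
  exists2 q : 'I_n -> C, (forall i, 0 <= q i <= 1) /\ \sum_i q i = \tr Q
    & \tr (B *m Q) = \sum_i spectral_diag B 0 i * q i.
Proof.
move=> Bh Qp; set W := spectralmx B.
have Wu : W \is unitarymx by exact: spectral_unitarymx.
have WV : W^t* *m W = 1%:M.
  by rewrite -invmx_unitary // mulVmx // unitarymx_unit.
have Q'p := orthoproj_conj Wu Qp.
exists (fun i => (W *m Q *m W^t*) i i).
  split=> [i|]; first by rewrite orthoproj_diag_ge0 ?orthoproj_diag_le1.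
  by rewrite -/(mxtrace _) mxtrace_mulC mulmxA WV mul1mx.
have /orthomx_spectralP {1}-> := hermitian_normalmx Bh.
rewrite -/W invmx_unitary // -!mulmxA mxtrace_mulC -!mulmxA.
rewrite /mxtrace; apply: eq_bigr => i _.
by rewrite mul_diag_mx mxE !mulmxA.
Qed.

(** Weights in [0, 1] make the combination of eigenvalues smallest when they
    select exactly the negative ones. *)
Lemma trace_mul_orthoproj_ge n (B Q : 'M[C]_n) :
    B \is hermsymmx -> orthoproj Q ->
  \sum_(i | spectral_diag B 0 i < 0) spectral_diag B 0 i <= \tr (B *m Q).
Proof.
move=> Bh Qp; have [q [q01 _] ->] := trace_mul_orthoproj Bh Qp.
rewrite big_mkcond /= ler_sum // => i _; have /andP[q0 q1] := q01 i.
have eR : spectral_diag B 0 i \is Num.real.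
  exact/mxOverP/hermitian_spectral_diag_real.
have [e0|e0] := real_ltP eR (real0 _); last by rewrite mulr_ge0.
by rewrite -{1}[spectral_diag B 0 i]mulr1 ler_wnM2l // ltW.
Qed.

Lemma trace_mul_orthoproj_le n (A Q : 'M[C]_n) (l : C) :
    A \is hermsymmx -> orthoproj Q ->
    (forall i, spectral_diag A 0 i <= l) -> \tr (A *m Q) <= l * \tr Q.
Proof.
move=> Ah Qp dl; have [q [q01 <-] ->] := trace_mul_orthoproj Ah Qp.
rewrite mulr_sumr ler_sum // => i _; have /andP[q0 _] := q01 i.
by rewrite ler_wpM2r.
Qed.

(** The projection is the spectral projection of A on the positive half-line. *)
Lemma pos_orthoproj n (A : 'M[C]_n) : A \is hermsymmx ->
  exists2 P, orthoproj P
    & \tr (A *m P) = \sum_(i | 0 < spectral_diag A 0 i) spectral_diag A 0 i.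
Proof.
move=> Ah; set W := spectralmx A; set d := spectral_diag A.
have Wu : W \is unitarymx by exact: spectral_unitarymx.
have W'u : W^t* \is unitarymx by rewrite trmxC_unitary.
pose S : 'rV[C]_n := \row_i (0 < d 0 i)%R%:R.
exists (W^t* *m diag_mx S *m W).
  rewrite -{2}[W]trmxCK; apply: orthoproj_conj => //; split.
    rewrite tr_diag_mx map_diag_mx; congr diag_mx.
    by apply/rowP=> i; rewrite !mxE /= conjC_nat.
  rewrite mulmx_diag; congr diag_mx.
  by apply/rowP=> i; rewrite !mxE -natrM mulnb andbb.
have /orthomx_spectralP {1}-> := hermitian_normalmx Ah.
rewrite -/W -/d invmx_unitary // !mulmxA mulmxtVK //.
rewrite mxtrace_mulC !mulmxA (unitarymxP Wu) mul1mx mulmx_diag mxtrace_diag.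
rewrite [RHS]big_mkcond /=; apply: eq_bigr => i _.
by rewrite !mxE mulr_natr mulrb.
Qed.

(** * Complementary spectra *)

(** The trace inequality behind the theorem. The bound [l] is required to be
    nonnegative because the projection [N] below vanishes when [u] is orthogonal
    to every eigenvector of A with positive eigenvalue. *)
Lemma sum_pos_spectrum_le n (A B : 'M[C]_n) (u : 'rV[C]_n) (l : C) :
    A \is hermsymmx -> B \is hermsymmx -> A + B + 1%:M = u^t* *m u ->
    0 <= l -> (forall i, spectral_diag A 0 i <= l) ->
  \sum_(i | 0 < spectral_diag A 0 i) spectral_diag A 0 i <=
  l - \sum_(i | spectral_diag B 0 i < 0) spectral_diag B 0 i.
Proof.
move=> Ah Bh ABu l0 dl; have [P [PH PP] <-] := pos_orthoproj Ah.
(* y is kept opaque so that products with y are recognized by rewriting. *)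
have [y yE] : exists y, y = u *m P by exists (u *m P).
pose s := (y *m y^t*) 0 0.
have yy : y *m y^t* = s%:M by rewrite [LHS]mx11_scalar.
have yP : y *m P = y by rewrite yE -mulmxA PP.
have Py : P *m y^t* = y^t* by rewrite -{1}PH -trmxCM yP.
have uy : u *m y^t* = s%:M.
  by rewrite -Py mulmxA -yE yy.
have yu : y *m u^t* = s%:M.
  by rewrite -{1}yP -mulmxA -{1}PH -trmxCM -yE.
have s0 : 0 <= s.
  by rewrite /s mxE sumr_ge0 // => k _; rewrite !mxE mul_conjC_ge0.
have sR : (s^-1)^* = s^-1 by rewrite geC0_conj ?invr_ge0.
(* The projection onto the line of y; if y = 0 then s^-1 = 0 and N = 0, so this
   case needs no separate construction. *)
pose N := s^-1 *: (y^t* *m y).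
have NN : N *m N = N.
  rewrite /N -scalemxAl -scalemxAr !mulmxA -(mulmxA _ y) yy.
  rewrite mul_mx_scalar -scalemxAl 2!scalerA.
  by have [->|sn] := eqVneq s 0; rewrite ?invr0 ?mul0r // mulVf ?mulr1.
have NH : N^t* = N.
  by rewrite /N linearZ /= map_mxZ /= sR trmxCM trmxCK.
have PN : P *m N = N by rewrite /N -scalemxAr mulmxA Py.
have NP : N *m P = N by rewrite /N -scalemxAl -mulmxA yP.
have Np : orthoproj N by split.
have Qp : orthoproj (P - N).
  split; first by rewrite linearB /= map_mxB PH NH.
  by rewrite mulmxBl !mulmxBr PP PN NP NN subrr subr0.
have trN : \tr N <= 1.
  rewrite /N mxtraceZ mxtrace_mulC yy mxtrace_scalar mulr1n.
  by have [->|sn] := eqVneq s 0; rewrite ?mulr0 ?mulVf.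
have uQu : \tr (u^t* *m u *m (P - N)) = 0.
  rewrite -mulmxA mxtrace_mulC mulmxBr mulmxBl -yE yu.
  rewrite /N -scalemxAr -scalemxAl !mulmxA uy -mulmxA yu.
  rewrite -scalar_mxM [LHS]raddfB /= mxtraceZ !mxtrace_scalar !mulr1n.
  by have [->|sn] := eqVneq s 0; rewrite ?mul0r ?mulr0 ?subr0 ?mulKf ?subrr.
have trQ : 0 <= \tr (P - N).
  by apply: sumr_ge0 => i _; apply: orthoproj_diag_ge0.
have AE : A = u^t* *m u - B - 1%:M by rewrite -ABu [A + B + _]addrAC !addrK.
have -> : \tr (A *m P) = \tr (A *m N) + \tr (A *m (P - N)).
  by rewrite -mxtraceD -mulmxDr addrC subrK.
apply: lerD.
  apply: le_trans (trace_mul_orthoproj_le Ah Np dl) _.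
  by rewrite -{2}[l]mulr1 ler_wpM2l.
move: (P - N) Qp uQu trQ => Q Qp uQu trQ.
rewrite AE 2!mulmxBl mul1mx 2!raddfB /= uQu sub0r -opprD lerN2 ler_wpDr //.
exact: trace_mul_orthoproj_ge.
Qed.

End Projections.

(** * Real symmetric matrices *)

Lemma map_complex_hermsymmx (R : rcfType) n (A : 'M[R]_n) :
  A^T = A -> map_mx (real_complex R) A \is hermsymmx.
Proof.
move=> AT; apply: realsym_hermsym.
  by apply/is_hermitianmxP; rewrite expr0 scale1r map_mx_id // map_trmx AT.
by apply/mxOverP=> i j; rewrite mxE; apply/complex_realP; exists (A i j).
Qed.

(** The real diagonal obtained by unitary diagonalization over R[i] lists the
    eigenvalues of A found in R: the two factorizations of the characteristic
    polynomial agree because they agree over R[i]. *)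
Lemma symmetric_spectrum (R : rcfType) n (A : 'M[R]_n) : A^T = A ->
  exists r : 'I_n -> R,
    [/\ forall i, spectral_diag (map_mx (real_complex R) A) 0 i = (r i)%:C%C,
        perm_eq (eigenvalues A) (codom r) & \sum_i r i = \tr A].
Proof.
move=> AT; set Ac := map_mx _ A; set d := spectral_diag Ac.
have Ach : Ac \is hermsymmx by exact: map_complex_hermsymmx.
have dR i : d 0 i \is Num.real.
  exact/mxOverP/hermitian_spectral_diag_real.
have AcE : Ac = invmx (spectralmx Ac) *m diag_mx d *m spectralmx Ac.
  exact/orthomx_spectralP/hermitian_normalmx.
have Wu : spectralmx Ac \in unitmx by exact: spectral_unit.
pose r i := complex.Re (d 0 i).
have rE i : d 0 i = (r i)%:C%C by rewrite RRe_real.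
exists r; split=> //.
  apply: perm_eigenvalues; apply: (map_poly_inj (real_complex R)).
  rewrite map_char_poly -/Ac AcE char_poly_conj //.
  rewrite char_poly_trig ?diag_mx_is_trig //.
  rewrite rmorph_prod /= big_map big_enum /=; apply: eq_bigr => i _.
  by rewrite mxE eqxx mulr1n rE map_polyXsubC.
apply: (@complexI R); rewrite rmorph_sum /= -trace_map_mx -/Ac AcE.
rewrite mxtrace_mulC mulmxA mulmxV // mul1mx mxtrace_diag.
by apply: eq_bigr => i _; rewrite rE.
Qed.

Lemma sum_norm_pos (R : realDomainType) n (r : 'I_n -> R) : \sum_i r i = 0 ->
  \sum_i `|r i| = 2%:R * \sum_(i | 0 < r i) r i.
Proof.
(* |x| + x is 2x for x > 0 and 0 otherwise. *)
move=> r0; rewrite -[LHS]addr0 -[X in _ + X = _]r0 -big_split /=.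
rewrite mulr_sumr [RHS]big_mkcond /=.
apply: eq_bigr => i _; case: ltrP => ri.
  by rewrite gtr0_norm // mulr_natl.
by rewrite ler0_norm // addNr.
Qed.

Lemma sum_norm_neg (R : realDomainType) n (r : 'I_n -> R) : \sum_i r i = 0 ->
  \sum_i `|r i| = - (2%:R * \sum_(i | r i < 0) r i).
Proof.
move=> r0; under eq_bigr do rewrite -normrN.
rewrite sum_norm_pos; last by rewrite sumrN r0 oppr0.
by under eq_bigl do rewrite oppr_gt0; rewrite sumrN mulrN.
Qed.

(** * Energies of complementary graphs *)

Lemma adjmx_sym (R : rcfType) n (G : sgraph n) : (adjmx R G)^T = adjmx R G.
Proof. by apply/matrixP=> i j; rewrite !mxE adj_sym. Qed.

Lemma adjmx_trace (R : rcfType) n (G : sgraph n) : \tr (adjmx R G) = 0.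
Proof. by rewrite /mxtrace big1 // => i _; rewrite mxE adj_irr. Qed.

(** The hypothesis says that G and H are complementary. In this form it is
    symmetric in G and H, so both inequalities of the theorem are instances. *)
Lemma energy_diff_le_lambda1 (R : rcfType) n (G H : sgraph n) :
    adjmx R G + adjmx R H + 1%:M = const_mx 1 ->
  energy R G - energy R H <= 2%:R * lambda1 R G.
Proof.
move=> GHJ; have GT := adjmx_sym R G; have HT := adjmx_sym R H.
have [r [dr rG]] := symmetric_spectrum GT.
have [e [de eH]] := symmetric_spectrum HT.
rewrite !adjmx_trace => e0 r0.
have -> : energy R G = 2%:R * \sum_(i | 0 < r i) r i.
  by rewrite /energy (perm_big _ rG) big_map big_enum sum_norm_pos.
have -> : energy R H = - (2%:R * \sum_(i | e i < 0) e i).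
  by rewrite /energy (perm_big _ eH) big_map big_enum sum_norm_neg.
rewrite opprK -mulrDr ler_pM2l ?ltr0n // -lerBrDr.
have rl i : r i <= lambda1 R G.
  rewrite /lambda1; apply: (le_bigmax_seq _ (r i) xpredT id) => //.
  by rewrite (perm_mem rG) codom_f.
(* The eigenvalues sum to zero, so the largest one cannot be negative; without
   vertices, lambda1 takes its default value 0. *)
have l0 : 0 <= lambda1 R G.
  case: n => [|n] in G H GHJ GT HT r dr rG e de eH e0 r0 rl *.
    have := perm_size rG; rewrite size_codom card_ord /lambda1 => /size0nil ->.
    by rewrite big_nil.
  have -> : (0 <= lambda1 R G) = (0 <= lambda1 R G *+ n.+1).
    by rewrite pmulrn_lge0.
  rewrite -[X in X <= _]r0.
  by rewrite -[X in _ *+ X](card_ord n.+1) -sumr_const ler_sum.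
rewrite -lecR rmorphB !rmorph_sum /=.
have -> : \sum_(i | 0 < r i) (r i)%:C%C =
    \sum_(i | 0 < spectral_diag (map_mx (real_complex R) (adjmx R G)) 0 i)
       spectral_diag (map_mx (real_complex R) (adjmx R G)) 0 i.
  by apply: eq_big => i; rewrite dr // -ltcR rmorph0.
have -> : \sum_(i | e i < 0) (e i)%:C%C =
    \sum_(i | spectral_diag (map_mx (real_complex R) (adjmx R H)) 0 i < 0)
       spectral_diag (map_mx (real_complex R) (adjmx R H)) 0 i.
  by apply: eq_big => i; rewrite de // -ltcR rmorph0.
apply: (@sum_pos_spectrum_le _ _ _ _ (const_mx 1)).
- exact: map_complex_hermsymmx.
- exact: map_complex_hermsymmx.
- rewrite -(map_mx1 (real_complex R)) -!map_mxD GHJ.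
  by apply/matrixP=> i j; rewrite !mxE big_ord1 !mxE /= conjC1 mulr1 rmorph1.
- by rewrite ler0c.
- by move=> i; rewrite dr lecR.
Qed.

Theorem theorem11 (R : rcfType) (n : nat) (G : sgraph n) :
  energy R G - energy R (compl G) <= 2%:R * lambda1 R G /\
  energy R (compl G) - energy R G <= 2%:R * lambda1 R (compl G).
Proof.
have E : adjmx R G + adjmx R (compl G) + 1%:M = const_mx 1.
  apply/matrixP=> i j; rewrite !mxE /= /compl_rel.
  case: eqVneq => [->|_]; first by rewrite adj_irr /= add0r add0r.
  by case: (G i j); rewrite /= ?addr0 ?add0r.
split; apply: energy_diff_le_lambda1 => //.
by rewrite [X in X + _]addrC.
Qed.
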